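(* Let $K = \{1, k_1, k_2,\dotsc, k_p\}$, where $p\ge 1$ and $1 < k_1 < k_2 < \cdots < k_p$ are integers, be such that $H^{\infty}_K(\mathbb{D})$ is an algebra. Let $z_1,z_2,\dotsc,z_n$ be distinct points in $\mathbb{D}$ and let $w_1,w_2,\dotsc,w_n$ be points in $\mathbb{D}$. If there is an $f \in H^{\infty}_K(\mathbb{D})$ such that $f(z_i) = w_i$ for $i = 1,2,\dotsc,n$ and $\|f\|_{\infty}\leq 1$, then there exists a $\lambda \in \mathbb{D}$ such that the $n\times n$ matrix $$\left[\frac{z_i^{m}\, \overline{z_j^{m}} - \varphi_{\lambda}(w_i)\, \overline{\varphi_{\lambda}(w_j)}}{1-z_i\overline{z_j}}\right]_{i,j=1}^n$$ is positive semidefinite, where $m$ is the smallest positive integer not in $K$.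
   Context: $\mathbb{D}$ is the open unit disk in $\mathbb{C}$ and $\mathbb{Z}_+$ is the set of positive integers. $H^{\infty}(\mathbb{D})$ is the set of bounded analytic functions on $\mathbb{D}$, with $\|f\|_\infty = \sup\{|f(z)| : z\in\mathbb{D}\}$. For a nonempty set $K\subset\mathbb{Z}_+$, $H^{\infty}_K(\mathbb{D}) = \{f\in H^{\infty}(\mathbb{D}) : f^{(k)}(0)=0 \text{ for all } k\in K\}$. Saying that $H^{\infty}_K(\mathbb{D})$ is an algebra means that it is an algebra under pointwise operations, i.e. it is closed under pointwise multiplication (which does not hold for every $K$). For $\lambda\in\mathbb{D}$, $\varphi_{\lambda}(z) = \frac{z-\lambda}{1-\overline{\lambda}z}$. *)

(* Defs.v *)
From mathcomp Require Import all_boot matrix.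
From Stdlib Require Import Reals.
From Coquelicot Require Import Coquelicot.

Set Implicit Arguments.
Unset Strict Implicit.
Unset Printing Implicit Defensive.

Local Open Scope C_scope.

Definition disk (z : C) : Prop := (Cmod z < 1)%R.

(* Functions on the disk are total functions C -> C whose values off the disk
   are irrelevant; none of the notions below depends on those values. *)

Definition analytic_at (f : C -> C) (a : C) : Prop :=
  exists c : nat -> C, exists r : R, (0 < r)%R /\
    forall z : C, (Cmod (z - a) < r)%R ->
      @is_pseries C_AbsRing C_NormedModule c (z - a) (f z).

Definition analytic_on_disk (f : C -> C) : Prop :=
  forall a : C, disk a -> analytic_at f a.

(* Valued in the extended reals: p_infty exactly when f is unbounded. *)
Definition sup_norm (f : C -> C) : Rbar :=
  Lub_Rbar (fun x : R => exists z : C, disk z /\ x = Cmod (f z)).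

Definition Hinf (f : C -> C) : Prop :=
  analytic_on_disk f /\
  exists M : R, forall z : C, disk z -> (Cmod (f z) <= M)%R.

(* C_derive is the limit of difference quotients along the real direction; for
   analytic f it is the complex derivative, and its iterates are f^(k). *)
Definition Hinf_vanishing (K : pred nat) (f : C -> C) : Prop :=
  Hinf f /\ forall k : nat, k \in K -> iter k C_derive f 0 = 0.

(* Hinf_vanishing K is always a linear space under pointwise operations, so
   being an algebra amounts to closure under products. *)
Definition is_algebra (A : (C -> C) -> Prop) : Prop :=
  forall f g : C -> C, A f -> A g -> A (fun z => f z * g z).

Definition mobius (lambda z : C) : C := (z - lambda) / (1 - Cconj lambda * z).

Definition quad_form n (A : 'M[C]_n) (x : 'I_n -> C) : C :=
  \big[Cplus/RtoC 0]_(i < n) \big[Cplus/RtoC 0]_(j < n)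
     (Cconj (x i) * A i j * x j).

(* A complex matrix with real quadratic form is automatically Hermitian. *)
Definition pos_semidef n (A : 'M[C]_n) : Prop :=
  forall x : 'I_n -> C, Im (quad_form A x) = 0%R /\ (0 <= Re (quad_form A x))%R.

(* Main.v *)
Require Import Defs.
From HB Require Import structures.
From mathcomp Require Import all_boot matrix.
From Stdlib Require Import Reals Lra Psatz.
From Coquelicot Require Import Coquelicot.

(* Take [lambda = f 0]; the 2 x 2 Pick matrix of [f] at [0] and some [z i] shows
   [|lambda| < 1].  All derivatives of [f] of order between 1 and [m - 1] vanish at 0,
   so [mobius lambda o f = z ^ m * h] with [h] holomorphic and [|h| <= r ^ -m] on the
   circle of radius [r].  On that circle the Szego kernels reproduce point values of
   holomorphic functions (Cauchy's formula, obtained by contracting the circle to the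
   point along segments).  For kernel sums [K] and [L] with [<h L, K> = |L|^2],
   expanding [|K - h L|^2 >= 0] gives [(2 - r ^ (-2 m)) |L|^2 <= |K|^2], and [r -> 1]
   yields the Pick inequality, with no need for the maximum principle. *)

(** The radius stays below 1 because [f] has no boundary values at its disposal. The price is the
    bound [r ^ -m] on [h] instead of 1; since [|h L|^2 <= r ^ (-2 m) |L|^2], it only perturbs a
    coefficient whose limit is harmless. The identity [<h L, K> = |L|^2] is an adjoint relation: the
    adjoint of multiplication by [h] sends the kernel at [a] to [Cconj (h a)] times itself, and the
    coefficients of [L] are those of [K] multiplied by these factors. Analyticity is replaced early
    by complex differentiability with a continuous derivative. That class is stable under the
    algebraic operations and under gluing of local formulas, and it is all that differentiation
    under the integral sign requires. Only real parts are integrated, so the real integral suffices;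
    that the final quadratic form is real comes separately, from Hermitian symmetry. *)

Set Implicit Arguments.
Unset Strict Implicit.
Unset Printing Implicit Defensive.

Local Open Scope R_scope.

(** * Complex differentiability *)

(* [ring] and [field] do not see through [UniformSpace.sort C_UniformSpace]. *)
Ltac cring := match goal with |- @eq _ ?a ?b => change (@eq C a b) end; ring.
Ltac cfield := match goal with |- @eq _ ?a ?b => change (@eq C a b) end; field.

Lemma Cminus_eq0 (x z : C) : (x - z)%C = RtoC 0 -> x = z.
Proof. by move=> xz; rewrite -[RHS]Cplus_0_r -xz; ring. Qed.

Lemma locally_imp2 (U : UniformSpace) (x : U) (P Q S : U -> Prop) :
  locally x P -> locally x Q -> (forall y, P y -> Q y -> S y) -> locally x S.
Proof. by move=> xP xQ PQS; apply: filter_imp (filter_and _ _ xP xQ) => y []; apply: PQS. Qed.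

(** * Continuity of complex-valued functions, by components *)

Lemma continuousCP (U : UniformSpace) (f : U -> C) x :
  continuous f x <->
  continuous (fun y => Re (f y)) x /\ continuous (fun y => Im (f y)) x.
Proof.
have ballP (V : UniformSpace) (g : U -> V) : continuous g x <->
    forall eps : posreal, locally x (fun y => ball (g x) eps (g y)).
  exact: filterlim_locally.
split=> [/ballP fc | [/ballP f1 /ballP f2]].
- by split; apply/ballP => eps; move: (fc eps); apply: filter_imp => y [].
- by apply/ballP => eps; apply: filter_and (f1 eps) (f2 eps).
Qed.

Lemma continuousC_plus (U : UniformSpace) (f g : U -> C) x :
  continuous f x -> continuous g x -> continuous (fun y => f y + g y)%C x.
Proof.
move=> /continuousCP[f1 f2] /continuousCP[g1 g2].
by apply/continuousCP; split; apply: (continuous_plus (V := R_NormedModule)).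
Qed.

Lemma continuousC_opp (U : UniformSpace) (f : U -> C) x :
  continuous f x -> continuous (fun y => - f y)%C x.
Proof.
move=> /continuousCP[f1 f2].
by apply/continuousCP; split; apply: (continuous_opp (V := R_NormedModule)).
Qed.

Lemma continuousC_minus (U : UniformSpace) (f g : U -> C) x :
  continuous f x -> continuous g x -> continuous (fun y => f y - g y)%C x.
Proof. by move=> fc gc; apply: continuousC_plus => //; apply: continuousC_opp. Qed.

Lemma continuousC_mult (U : UniformSpace) (f g : U -> C) x :
  continuous f x -> continuous g x -> continuous (fun y => f y * g y)%C x.
Proof.
move=> /continuousCP[f1 f2] /continuousCP[g1 g2]; apply/continuousCP; split.
- by apply: (continuous_minus (V := R_NormedModule));
    apply: (continuous_mult (K := R_AbsRing)).
- by apply: (continuous_plus (V := R_NormedModule));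
    apply: (continuous_mult (K := R_AbsRing)).
Qed.

Lemma continuousC_conj (U : UniformSpace) (f : U -> C) x :
  continuous f x -> continuous (fun y => Cconj (f y)) x.
Proof.
move=> /continuousCP[f1 f2]; apply/continuousCP; split => //.
exact: (continuous_opp (V := R_NormedModule)).
Qed.

Lemma continuousC_RtoC (U : UniformSpace) (f : U -> R) x :
  continuous f x -> continuous (fun y => RtoC (f y)) x.
Proof.
by move=> fc; apply/continuousCP; split => //; apply: continuous_const.
Qed.

Lemma continuousC_inv (U : UniformSpace) (f : U -> C) x :
  continuous f x -> f x <> RtoC 0 -> continuous (fun y => / f y)%C x.
Proof.
move=> /continuousCP[f1 f2] fx0.
have n0 : (Re (f x)) ^ 2 + (Im (f x)) ^ 2 <> 0.
  by rewrite -Cmod2_alt; apply: pow_nonzero => /Cmod_eq_0.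
have c2 : continuous (fun y => / ((Re (f y)) ^ 2 + (Im (f y)) ^ 2)) x.
  apply: (continuous_comp (fun y => (Re (f y)) ^ 2 + (Im (f y)) ^ 2) Rinv).
    apply: (continuous_plus (V := R_NormedModule)) => /=;
    by do 2?[apply: (continuous_mult (K := R_AbsRing)) => //];
      apply: continuous_const.
  exact: continuous_Rinv.
apply/continuousCP; split; apply: (continuous_mult (K := R_AbsRing)) => //.
exact: (continuous_opp (V := R_NormedModule)).
Qed.

Lemma locallyC_Cmod (z : C) (d : R) (P : C -> Prop) :
  0 < d -> (forall x, Cmod (x - z) < d -> P x) -> locally z P.
Proof.
move=> d0 dP.
have s2 : 0 < sqrt 2 by apply: sqrt_lt_R0; lra.
(* Balls of [C] are squares; the one of half-side [d / sqrt 2] lies in the disc of radius [d]. *)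
have e'0 : 0 < d / sqrt 2 by apply: Rdiv_lt_0_compat.
exists (mkposreal _ e'0) => x xe; apply: dP.
by apply: Rlt_le_trans (C_NormedModule_mixin_compat2 _ _ _ xe) _; right => /=; field; lra.
Qed.

Lemma continuousC_lipschitz (f : C -> C) z M d :
  0 < d -> (forall x, Cmod (x - z) < d -> Cmod (f x - f z) <= M * Cmod (x - z)) ->
  continuous f z.
Proof.
move=> d0 fM; have M0 := Rabs_pos M; have MM := Rle_abs M.
apply/filterlim_locally => eps.
have e0 : 0 < eps / (Rabs M + 1) by apply: Rdiv_lt_0_compat; [apply: cond_pos | lra].
apply: (locallyC_Cmod (Rmin_pos _ _ d0 e0)) => x xe.
have xd : Cmod (x - z) < d by apply: Rlt_le_trans xe (Rmin_l _ _).
have xe' : Cmod (x - z) < eps / (Rabs M + 1) by apply: Rlt_le_trans xe (Rmin_r _ _).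
apply: C_NormedModule_mixin_compat1; apply: Rle_lt_trans (fM _ xd) _.
have c0 := Cmod_ge_0 (x - z).
have h : (Rabs M + 1) * Cmod (x - z) < eps.
  apply: (Rlt_le_trans _ ((Rabs M + 1) * (eps / (Rabs M + 1)))).
    by apply: Rmult_lt_compat_l => //; lra.
  by right; field; lra.
nra.
Qed.

(* Caratheodory's form of complex differentiability. *)
Definition cdiff (F : C -> C) (z d : C) : Prop :=
  exists phi : C -> C, [/\ continuous phi z, phi z = d
    & locally z (fun x => (F x - F z = phi x * (x - z))%C)].

Lemma cdiff_continuous F z d : cdiff F z d -> continuous F z.
Proof.
move=> [phi [pc _ E]].
apply: (continuous_ext_loc _ (fun x => F z + phi x * (x - z))%C).
  by move: E; apply: filter_imp => x E; rewrite -E; cring.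
apply: continuousC_plus; first exact: continuous_const.
apply: continuousC_mult => //.
by apply: continuousC_minus; [apply: continuous_id | apply: continuous_const].
Qed.

Lemma cdiff_const c z : cdiff (fun=> c) z 0.
Proof.
exists (fun=> RtoC 0); split => //; first exact: continuous_const.
by apply: filter_forall => x; ring.
Qed.

Lemma cdiff_id z : cdiff (fun x => x) z 1.
Proof.
exists (fun=> RtoC 1); split => //; first exact: continuous_const.
by apply: filter_forall => x; ring.
Qed.

Lemma cdiff_plus F G z f g :
  cdiff F z f -> cdiff G z g -> cdiff (fun x => F x + G x)%C z (f + g).
Proof.
move=> [p [pc <- pE]] [q [qc <- qE]]; exists (fun x => p x + q x)%C; split => //.
  exact: continuousC_plus.
apply: (locally_imp2 pE qE) => x Ep Eq.
by rewrite Cmult_plus_distr_r -Ep -Eq; ring.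
Qed.

Lemma cdiff_mult F G z f g :
  cdiff F z f -> cdiff G z g -> cdiff (fun x => F x * G x)%C z (f * G z + F z * g).
Proof.
move=> Fd [q [qc <- qE]]; have Fc := cdiff_continuous Fd.
case: Fd => p [pc <- pE]; exists (fun x => p x * G z + F x * q x)%C; split => //.
  apply: continuousC_plus; apply: continuousC_mult => //.
  exact: continuous_const.
apply: (locally_imp2 pE qE) => x Ep Eq.
transitivity ((F x - F z) * G z + F x * (G x - G z))%C; first by ring.
by rewrite Ep Eq; ring.
Qed.

Lemma cdiff_ext_loc F G z d :
  locally z (fun x => F x = G x) -> cdiff F z d -> cdiff G z d.
Proof.
move=> FG [p [pc <- pE]]; exists p; split => //.
have Fz := locally_singleton _ _ FG.
apply: (locally_imp2 FG pE) => x E.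
by rewrite E Fz.
Qed.

Lemma continuousC_neq0 (F : C -> C) z :
  continuous F z -> F z <> RtoC 0 -> locally z (fun x => F x <> RtoC 0).
Proof.
move=> Fc F0.
have d0 : 0 < Cmod (F z) by apply/Cmod_gt_0.
apply: (Fc (fun c => c <> RtoC 0)); apply: (locallyC_Cmod d0) => x xd x0; move: xd; rewrite x0.
have -> : (0 - F z = - F z)%C by ring.
by rewrite Cmod_opp; lra.
Qed.

Lemma cdiff_inv F z f :
  cdiff F z f -> F z <> RtoC 0 -> cdiff (fun x => / F x)%C z (- (f / (F z * F z))).
Proof.
move=> Fd F0; have Fc := cdiff_continuous Fd.
case: Fd => p [pc <- pE].
exists (fun x => - (p x * / (F x * F z)))%C; split => //.
  apply: continuousC_opp; apply: continuousC_mult => //.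
  apply: continuousC_inv; last exact: Cmult_neq_0.
  by apply: continuousC_mult => //; apply: continuous_const.
apply: (locally_imp2 pE (continuousC_neq0 Fc F0)) => x Ep Fx.
have -> : (- (p x * / (F x * F z)) * (x - z) = - ((p x * (x - z)) / (F x * F z)))%C.
  by rewrite /Cdiv; ring.
by rewrite -Ep; field.
Qed.

(** [C_derive] probes the real direction only; the continuous slope function supplies the full
    complex limit, which determines it. *)
Lemma cdiff_C_derive F z d : cdiff F z d -> C_derive F z = d.
Proof.
move=> [p [pc <- pE]]; apply: is_C_lim_unique.
apply: (filterlim_ext_loc p); last first.
  by apply: filterlim_filter_le_1 pc; apply: filter_le_within.
move: pE; apply: filter_imp => x E xz; rewrite E; cfield => x0; apply: xz.
exact: Cminus_eq0.
Qed.

(** A quadratic remainder puts the difference quotient within [M * Cmod (x - z)] of [d], so it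
    extends continuously to [z]. Power series are differentiated through this criterion. *)
Lemma cdiff_quadratic (F : C -> C) z d M e :
  0 < e ->
  (forall x, Cmod (x - z) < e ->
     Cmod (F x - F z - d * (x - z)) <= M * (Cmod (x - z) * Cmod (x - z))) ->
  cdiff F z d.
Proof.
move=> e0 FM.
have zz : (z - z = 0)%C by cring.
pose p x := if Req_EM_T (Cmod (x - z)) 0 then d else ((F x - F z) / (x - z))%C.
have pz : p z = d by rewrite /p; case: Req_EM_T => // n0; case: n0; rewrite zz Cmod_0.
exists p; split => //.
- apply: (continuousC_lipschitz (M := M) e0) => x /FM {FM}; rewrite pz /p.
  case: Req_EM_T => [x0 _|x0 FM].
    by have -> : (d - d = 0)%C by [cring]; rewrite Cmod_0 x0; lra.
  have x1 : (x - z)%C <> RtoC 0 by move=> x1; apply: x0; rewrite x1 Cmod_0.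
  have -> : ((F x - F z) / (x - z) - d = (F x - F z - d * (x - z)) / (x - z))%C.
    by cfield.
  rewrite Cmod_div //.
  have c0 : 0 < Cmod (x - z) by apply/Cmod_gt_0.
  by apply/Rle_div_l => //; rewrite Rmult_assoc.
- apply: filter_forall => x; rewrite /p; case: Req_EM_T => [x0|x0] /=.
    have -> := Cminus_eq0 (Cmod_eq_0 _ x0).
    by cring.
  by cfield => x1; apply: x0; rewrite x1 Cmod_0.
Qed.

(** * Complex power series *)

Notation is_Cseries := (@is_series C_AbsRing C_NormedModule).

Lemma Re_sum_n (a : nat -> C) n :
  Re (sum_n (G := C_AbelianMonoid) a n) = sum_n (fun k => Re (a k)) n.
Proof. by elim: n => [|n IH]; rewrite ?sum_O // !sum_Sn -IH. Qed.

Lemma Im_sum_n (a : nat -> C) n :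
  Im (sum_n (G := C_AbelianMonoid) a n) = sum_n (fun k => Im (a k)) n.
Proof. by elim: n => [|n IH]; rewrite ?sum_O // !sum_Sn -IH. Qed.

Lemma is_Cseries_comp a l :
  is_Cseries a l <->
  is_series (fun n => Re (a n)) (Re l) /\ is_series (fun n => Im (a n)) (Im l).
Proof.
have limP (V : UniformSpace) (g : nat -> V) (y : V) : filterlim g eventually (locally y) <->
    forall eps : posreal, eventually (fun n => ball y eps (g n)).
  exact: filterlim_locally.
split=> [/limP L | [/limP L1 /limP L2]].
  split; apply/limP => eps; have [N NP] := L eps; exists N => n /NP [].
    by move=> + _; rewrite -Re_sum_n.
  by move=> _; rewrite -Im_sum_n.
apply/limP => eps; have [N1 P1] := L1 eps; have [N2 P2] := L2 eps.
exists (maxn N1 N2) => n /leP; rewrite geq_max => /andP[/leP /P1 h1 /leP /P2 h2].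
by rewrite -Re_sum_n in h1; rewrite -Im_sum_n in h2.
Qed.

Lemma is_Cseries_unique a l1 l2 : is_Cseries a l1 -> is_Cseries a l2 -> l1 = l2.
Proof.
move=> /is_Cseries_comp[/is_series_unique h1 /is_series_unique h2].
move=> /is_Cseries_comp[/is_series_unique k1 /is_series_unique k2].
apply: injective_projections; first by change (Re l1 = Re l2); rewrite -h1.
by change (Im l1 = Im l2); rewrite -h2.
Qed.

Lemma is_Cseries_le a l b :
  is_Cseries a l -> (forall n, Cmod (a n) <= b n) -> ex_series b -> Cmod l <= Series b.
Proof.
move=> al ab /Series_correct bl.
have L : is_lim_seq (fun n => Cmod (sum_n (G := C_AbelianMonoid) a n)) (Cmod l).
  exact: filterlim_comp al (filterlim_norm (V := C_NormedModule) l).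
have {}bl : is_lim_seq (sum_n b) (Series b) by [].
suff h n : Cmod (sum_n (G := C_AbelianMonoid) a n) <= sum_n b n.
  by apply: (is_lim_seq_le _ _ _ _ h L bl).
apply: Rle_trans (norm_sum_n_m (V := C_NormedModule) a 0 n) _.
by apply: sum_n_m_le => k; apply: ab.
Qed.

Definition cps (c : nat -> C) (z l : C) := is_Cseries (fun n => c n * z ^ n)%C l.

Lemma cpsE c z l : cps c z l <-> @is_pseries C_AbsRing C_NormedModule c z l.
Proof.
have E n : (c n * z ^ n)%C = scal (pow_n (K := C_AbsRing) z n) (c n : C_NormedModule).
  have -> : pow_n (K := C_AbsRing) z n = Cpow z n by elim: n => //= n ->.
  by rewrite Cmult_comm.
by split; apply: is_series_ext => n; rewrite E.
Qed.

Lemma is_Cseries_bounded a l : is_Cseries a l -> exists M, forall n, Cmod (a n) <= M.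
Proof.
move=> /is_Cseries_comp[h1 h2].
have bd (u : nat -> R) v : is_series u v -> exists M, forall n, Rabs (u n) <= M.
  move=> h; have u0 := ex_series_lim_0 u (ex_intro _ _ h).
  have [M bM] := filterlim_bounded (V := R_NormedModule) u (ex_intro _ 0 u0).
  by exists M.
have [M1 b1] := bd _ _ h1; have [M2 b2] := bd _ _ h2.
exists (sqrt 2 * (M1 + M2)) => n; apply: Rle_trans (Cmod_2Rmax _) _.
apply: Rmult_le_compat_l; first exact: sqrt_pos.
have := b1 n; have := b2 n; have := Rabs_pos (Re (a n)); have := Rabs_pos (Im (a n)).
by rewrite /Re /Im => *; apply: Rmax_lub; lra.
Qed.

(** Convergence at [s] bounds the terms [c n * s ^ n], so the real series with coefficients
    [Cmod (c n)] has radius at least [s]. The theory of real power series then provides the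
    dominating series. *)
Lemma cps_CV_radius c (s x : R) l :
  0 <= x < s -> cps c s l -> Rbar_lt (Rabs x) (CV_radius (fun n => Cmod (c n))).
Proof.
move=> [x0 xs] /is_Cseries_bounded [M bM].
apply: (Rbar_lt_le_trans _ s); first by rewrite /= Rabs_pos_eq.
apply: (proj1 (CV_radius_bounded _)); exists M => n; apply: Rle_trans (bM n).
rewrite Cmod_mult Cmod_pow Cmod_R Rabs_mult RPow_abs Rabs_pos_eq; last exact: Cmod_ge_0.
lra.
Qed.

Definition dps (c : nat -> C) (n : nat) : C := (INR n.+1 * c n.+1)%C.

(** If [R_n] denotes the remainder for the exponent [n + 2], then [R_(n+1) = z R_n + (n + 2) w ^ (n
    + 1) (z - w) ^ 2]. The constant is twice the sharp one, but it is exactly the factor produced by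
    differentiating a power series twice, so the bounds can be summed. *)
Lemma pow_taylor1 (z w : C) (s : R) n : Cmod z <= s -> Cmod w <= s ->
  Cmod (z ^ n.+2 - w ^ n.+2 - INR n.+2 * w ^ n.+1 * (z - w))
   <= INR n.+2 * INR n.+1 * s ^ n * (Cmod (z - w) * Cmod (z - w)).
Proof.
move=> zs ws; have s0 : 0 <= s by apply: Rle_trans zs; apply: Cmod_ge_0.
elim: n => [|n IH].
  have -> : (z ^ 2 - w ^ 2 - INR 2 * w ^ 1 * (z - w) = (z - w) * (z - w))%C.
    by rewrite /= RtoC_plus; ring.
  by rewrite Cmod_mult /=; have := Cmod_ge_0 (z - w); nra.
set d := Cmod (z - w) in IH *.
have d0 : 0 <= d by apply: Cmod_ge_0.
have -> : (z ^ n.+3 - w ^ n.+3 - INR n.+3 * w ^ n.+2 * (z - w) =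
   z * (z ^ n.+2 - w ^ n.+2 - INR n.+2 * w ^ n.+1 * (z - w)) +
   INR n.+2 * w ^ n.+1 * ((z - w) * (z - w)))%C.
  by rewrite (S_INR n.+2) RtoC_plus !Cpow_S; ring.
apply: Rle_trans (Cmod_triangle _ _) _.
rewrite !Cmod_mult Cmod_R Cmod_pow -/d.
have n2 : 0 <= INR n.+2 by apply: pos_INR.
rewrite (Rabs_pos_eq (INR _)) //.
have sn : 0 <= s ^ n.+1 by apply: pow_le.
have wn : Cmod w ^ n.+1 <= s ^ n.+1.
  by apply: pow_incr; split => //; apply: Cmod_ge_0.
set T := Cmod _ in IH *.
have T0 : 0 <= T by apply: Cmod_ge_0.
have h1 : Cmod z * T <= s * (INR n.+2 * INR n.+1 * s ^ n * (d * d)).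
  by apply: Rmult_le_compat => //; apply: Cmod_ge_0.
have h2 : INR n.+2 * Cmod w ^ n.+1 * (d * d) <= INR n.+2 * s ^ n.+1 * (d * d).
  apply: Rmult_le_compat_r; first by nra.
  exact: Rmult_le_compat_l.
apply: Rle_trans (Rplus_le_compat _ _ _ _ h1 h2) _.
rewrite (S_INR n.+2) (S_INR n.+1) -[s ^ n.+1]/(s * s ^ n).
have dd : 0 <= s * s ^ n * (d * d) by apply: Rmult_le_pos => //; nra.
have := pos_INR n.+1.
set t := s * s ^ n * _ in dd *; move=> n1.
have -> : s * ((INR n.+1 + 1) * INR n.+1 * s ^ n * (d * d)) =
    (INR n.+1 + 1) * INR n.+1 * t by rewrite /t; ring.
have -> : (INR n.+1 + 1) * (s * s ^ n) * (d * d) =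
    (INR n.+1 + 1) * t by rewrite /t; ring.
have -> : (INR n.+1 + 1 + 1) * (INR n.+1 + 1) * (s * s ^ n) * (d * d) =
    (INR n.+1 + 1 + 1) * (INR n.+1 + 1) * t by rewrite /t; ring.
by nra.
Qed.

Lemma cps_derive c r f : (forall z, Cmod z < r -> cps c z (f z)) ->
  forall w, Cmod w < r -> cps (dps c) w (C_derive f w) /\ cdiff f w (C_derive f w).
Proof.
move=> fc w wr.
(* Here [|w| < s < s' < r]: convergence at [s'] gives convergence at [s] of the once and twice
   differentiated series of moduli, and [s] bounds every point closer to [w] than [s - |w|]. *)
pose s := (Cmod w + r) / 2; pose s' := (s + r) / 2.
have w0 := Cmod_ge_0 w.
have ws : Cmod w < s by rewrite /s; lra.
have ss' : s < s' by rewrite /s' /s; lra.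
have s'r : s' < r by rewrite /s' /s; lra.
have s'C : cps c s' (f s') by apply: fc; rewrite Cmod_R Rabs_pos_eq; lra.
have sCV : Rbar_lt (Rabs s) (CV_radius (fun n => Cmod (c n))).
  by apply: cps_CV_radius s'C; lra.
pose b := fun n => Cmod (c n).
have b0 n : 0 <= b n by apply: Cmod_ge_0.
have ex1 : ex_series (fun n => PS_derive b n * s ^ n).
  by apply/ex_pseries_R; apply: ex_pseries_derive.
have ex2 : ex_series (fun n => PS_derive (PS_derive b) n * s ^ n).
  by apply/ex_pseries_R; apply: ex_pseries_derive; rewrite CV_radius_derive.
have [g gP] : exists g, cps (dps c) w g.
  apply: (ex_series_le (V := C_CompleteNormedModule) _ _ _ ex1) => n.
  rewrite -[norm _]/(Cmod _) /dps !Cmod_mult Cmod_R Cmod_pow /PS_derive -/(b n.+1).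
  rewrite (Rabs_pos_eq (INR _)); last exact: pos_INR.
  apply: Rmult_le_compat_l; first by apply: Rmult_le_pos => //; apply: pos_INR.
  by apply: pow_incr; split => //; lra.
suff dg : cdiff f w g by rewrite (cdiff_C_derive dg).
have rs : 0 < s - Cmod w by lra.
apply: (cdiff_quadratic (M := Series (fun n => PS_derive (PS_derive b) n * s ^ n)) rs).
move=> z zw.
have zs : Cmod z < s.
  have := Cmod_triangle (z - w) w; have -> : (z - w + w = z)%C by ring.
  by lra.
have zr : Cmod z < r by lra.
(* A linear combination of the series for [f z], [f w] and [g] writes the first-order remainder of
   [f] as the series of the remainders of the monomials. *)
have S0 := is_series_plus _ _ _ _ (fc z zr)
   (is_series_scal (V := C_NormedModule) (RtoC (-1) : C_AbsRing) _ _ (fc w wr)).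
have S1 : is_Cseries (fun n => c n * (INR n * w ^ n.-1))%C g.
  apply: is_series_decr_1.
  have -> : plus g (opp (c O * (INR O * w ^ (O.-1)) : C_NormedModule)%C) = g.
    rewrite /plus /opp /=; ring.
  by apply: is_series_ext gP => n; rewrite /dps /=; ring.
have S2 := is_series_plus _ _ _ _ S0
   (is_series_scal (V := C_NormedModule) (- (z - w) : C_AbsRing)%C _ _ S1).
set l := plus _ _ in S2.
have -> : (f z - f w - g * (z - w))%C = l by rewrite /l /plus /scal /= /mult /=; ring.
have {}S2 : is_Cseries (fun n => c n * (z ^ n - w ^ n - INR n * w ^ n.-1 * (z - w)))%C l.
  apply: is_series_ext S2 => n; rewrite /plus /scal /= /mult /=; ring.
rewrite Rmult_comm -Series_scal_l.
(* The terms of index 0 and 1 of the Taylor remainder vanish. *)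
have S3 : is_Cseries (fun n => c n.+2 * (z ^ n.+2 - w ^ n.+2 - INR n.+2 * w ^ n.+1 * (z - w)))%C l.
  apply: (is_series_incr_1
    (fun n => c n.+1 * (z ^ n.+1 - w ^ n.+1 - INR n.+1 * w ^ n * (z - w)))%C).
  have -> : plus l (c (S O) * (z ^ 1 - w ^ 1 - INR (S O) * w ^ O * (z - w)) : C_NormedModule)%C = l.
    by rewrite /plus /=; ring.
  apply: (is_series_incr_1
    (fun n => c n * (z ^ n - w ^ n - INR n * w ^ n.-1 * (z - w)))%C).
  have -> : plus l (c O * (z ^ O - w ^ O - INR O * w ^ (O.-1) * (z - w)) : C_NormedModule)%C = l.
    by rewrite /plus /=; ring.
  exact: S2.
apply: (is_Cseries_le S3) => [n|]; last exact: (ex_series_scal_l (K := R_AbsRing)).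
have := pow_taylor1 n (Rlt_le _ _ zs) (Rlt_le _ _ ws) => /(Rmult_le_compat_l _ _ _ (b0 n.+2)) h.
rewrite Cmod_mult; apply: Rle_trans h _; right; rewrite /PS_derive; ring.
Qed.

Lemma cps_0 c : cps c 0 (c O).
Proof.
apply: is_series_decr_1.
apply: (is_series_ext (fun=> zero)).
  by move=> n; rewrite /zero /=; ring.
have -> : plus (c O) (opp (c O * 0 ^ O)%C) = (zero : C_NormedModule).
  by rewrite /plus /opp /zero /=; ring.
apply: filterlim_ext (filterlim_const _) => n.
by elim: n => [|n IH]; rewrite ?sum_O // sum_Sn -IH plus_zero_l.
Qed.

(** Division by [z ^ m] only shifts the coefficients. The shifted series also makes sense at 0,
    which is what removes the singularity there. *)
Lemma cps_shift (c : nat -> C) m z l : z <> RtoC 0 -> (forall k, (0 < k < m)%nat -> c k = 0) ->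
  (0 < m)%nat -> cps c z l ->
  cps (fun k => c (m + k)%nat) z ((l - c O) / z ^ m)%C.
Proof.
move=> z0 ck m0 cl; have zm := Cpow_nz z m z0.
have S : forall j, (j < m)%nat ->
    sum_n (fun n => c n * z ^ n : C_NormedModule)%C j = c O.
  elim=> [_|j IH jm]; first by rewrite sum_O /=; ring.
  rewrite sum_Sn IH ?(ltnW jm) // (ck j.+1) // Cmult_0_l.
  by apply: (plus_zero_r (G := C_AbelianGroup)).
have h : is_Cseries (fun k => c (m + k)%nat * z ^ (m + k)%nat)%C (l - c O)%C.
  apply: (is_series_incr_n (fun n => c n * z ^ n : C_NormedModule)%C); first exact/ltP.
  rewrite S ?prednK //; have -> : plus (l - c O : C_NormedModule)%C (c O) = l; last by [].
  by rewrite /plus /=; ring.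
have := is_series_scal (V := C_NormedModule) (/ z ^ m : C_AbsRing)%C _ _ h.
have -> : scal (/ z ^ m : C_AbsRing)%C (l - c O : C_NormedModule)%C = ((l - c O) / z ^ m)%C.
  by rewrite /scal /= /mult /= Cmult_comm.
apply: is_series_ext => k; rewrite /scal /= /mult /= Cpow_add_r.
by field.
Qed.

Lemma cps_iter_derive c r f k : 0 < r -> (forall z, Cmod z < r -> cps c z (f z)) ->
  iter k C_derive f 0 = (INR (Factorial.fact k) * c k)%C.
Proof.
move=> r0; elim: k f c => [|k IH] f c fc.
  rewrite /= (is_Cseries_unique (fc 0 _) (@cps_0 c)); last by rewrite Cmod_0.
  by ring.
rewrite iterSr (IH _ (dps c)); last by move=> z /(cps_derive fc) [].
rewrite /dps fact_simpl mult_INR RtoC_mult; ring.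
Qed.

(** * Cauchy's formula on circles *)

(** The derivative is explicit and continuous for the sake of differentiation under the integral
    sign. The set [A] varies: the disk, the punctured disk, or a small ball. *)
Definition holomorphic_on (A : C -> Prop) (F F' : C -> C) : Prop :=
  forall z, A z -> cdiff F z (F' z) /\ continuous F' z.

Notation holomorphic := (holomorphic_on disk).

Lemma Ci2 : (Ci * Ci = - (1))%C.
Proof. by apply: injective_projections => /=; ring. Qed.

Definition circle (r t : R) : C := (r * cos t, r * sin t).

Lemma Cmod_circle r t : 0 <= r -> Cmod (circle r t) = r.
Proof.
move=> r0; rewrite /Cmod /circle /=; apply: sqrt_lem_1 => //; first by nra.
have := sin2_cos2 t; rewrite /Rsqr => sc.
have -> : r * cos t * (r * cos t * 1) + r * sin t * (r * sin t * 1) =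
  r * r * (sin t * sin t + cos t * cos t) by ring.
by rewrite sc; ring.
Qed.

Lemma continuous_circle r t : continuous (circle r) t.
Proof.
apply/continuousCP; split; apply: (continuous_mult (K := R_AbsRing));
  by [apply: continuous_const | apply: continuous_cos | apply: continuous_sin].
Qed.

(** The second factor vanishes at [t], so mere continuity of [p] is enough for the product rule.
    This is the situation when a Caratheodory slope is composed with a path. *)
Lemma is_derive_mul_vanishing (p q : R -> R) t q' :
  continuous p t -> is_derive q t q' ->
  is_derive (fun s => p s * (q s - q t)) t (p t * q').
Proof.
move=> pc /is_derive_Reals dq; apply/is_derive_Reals => eps eps0.
(* The error splits as [P * (Q - q') + (P - p t) * q']. The constants keep each summand below
   [eps / 2], and the minimum with 1 ensures [|P| < |p t| + 1]. *)
have k1 : 0 < eps / (2 * (Rabs (p t) + 1)).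
  by apply: Rdiv_lt_0_compat => //; have := Rabs_pos (p t); lra.
have k2 : 0 < Rmin 1 (eps / (2 * (Rabs q' + 1))).
  apply: Rmin_pos; first lra.
  by apply: Rdiv_lt_0_compat => //; have := Rabs_pos q'; lra.
have [d1 D1] := dq _ k1.
have [d2 D2] : locally t (fun s => Rabs (p s - p t) < Rmin 1 (eps / (2 * (Rabs q' + 1)))).
  exact: (pc _ (locally_ball (p t) (mkposreal _ k2))).
have d0 : 0 < Rmin d1 d2 by apply: Rmin_pos; apply: cond_pos.
exists (mkposreal _ d0) => h h0 /= hd.
have {D1} := D1 h h0 (Rlt_le_trans _ _ _ hd (Rmin_l _ _)).
have : Rabs (p (t + h) - p t) < Rmin 1 (eps / (2 * (Rabs q' + 1))).
  apply: D2; rewrite /ball /= /AbsRing_ball /abs /minus /plus /opp /=.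
  have -> : t + h + - t = h by ring.
  exact: Rlt_le_trans hd (Rmin_r _ _).
set Q := (q (t + h) - q t) / h; set P := p (t + h) => hP hQ.
have -> : (P * (q (t + h) - q t) - p t * (q t - q t)) / h - p t * q' =
   P * (Q - q') + (P - p t) * q' by rewrite /Q; field.
have hP1 := Rlt_le_trans _ _ _ hP (Rmin_l _ _).
have hP2 := Rlt_le_trans _ _ _ hP (Rmin_r _ _).
apply: Rle_lt_trans (Rabs_triang _ _) _; rewrite !Rabs_mult.
have Pp : Rabs P < Rabs (p t) + 1.
  have := Rabs_triang (P - p t) (p t); have -> : P - p t + p t = P by ring.
  by lra.
have p0 := Rabs_pos (p t); have q0 := Rabs_pos q'.
have e1 : (Rabs (p t) + 1) * (eps / (2 * (Rabs (p t) + 1))) = eps / 2 by field; lra.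
have e2 : (Rabs q' + 1) * (eps / (2 * (Rabs q' + 1))) = eps / 2 by field; lra.
have := Rabs_pos (Q - q'); have := Rabs_pos (P - p t); have := Rabs_pos P.
by nra.
Qed.


(** The free factor [b] carries the weight of the integrals below; taking it to be a multiple of
    [- Ci] gives access to imaginary parts as well. *)
Lemma is_derive_cdiff (F : C -> C) (g : R -> C) t d v :
  cdiff F (g t) d -> is_derive (fun s => Re (g s)) t (Re v) ->
  is_derive (fun s => Im (g s)) t (Im v) ->
  forall b : C, is_derive (fun s => Re (F (g s) * b)) t (Re (d * v * b)).
Proof.
move=> [p [pc <- pE]] d1 d2 b.
have gc : continuous g t.
  by apply/continuousCP; split; apply: ex_derive_continuous; eexists; eassumption.
have pbc : continuous (fun s => p (g s) * b)%C t.
  apply: continuousC_mult; last exact: continuous_const.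
  exact: (continuous_comp g p).
have [pb1 pb2] := proj1 (continuousCP _ _) pbc.
apply: (is_derive_ext_loc (fun s => Re (F (g t) * b) + (Re (p (g s) * b) * (Re (g s) - Re (g t))
   - Im (p (g s) * b) * (Im (g s) - Im (g t))))).
  have : locally t (fun s => (F (g s) - F (g t) = p (g s) * (g s - g t))%C) by apply: gc pE.
  apply: filter_imp => s Es.
  have -> : F (g s) = (F (g t) + p (g s) * (g s - g t))%C by rewrite -Es; ring.
  by rewrite /Re /Im /=; ring.
have -> : Re (p (g t) * v * b) = 0 + (Re (p (g t) * b) * Re v - Im (p (g t) * b) * Im v).
  by rewrite /Re /Im /=; ring.
apply: (is_derive_plus (V := R_NormedModule)); first exact: is_derive_const.
by apply: (is_derive_minus (V := R_NormedModule)); apply: is_derive_mul_vanishing.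
Qed.


Lemma circle_2PI r : circle r (2 * PI) = circle r 0.
Proof. by rewrite /circle cos_2PI sin_2PI cos_0 sin_0. Qed.

Lemma is_RInt_closed (H h : R -> R) :
  (forall t, is_derive H t (h t)) -> (forall t, continuous h t) ->
  H (2 * PI) = H 0 -> is_RInt h 0 (2 * PI) 0.
Proof.
move=> dH ch HE.
have := is_RInt_derive (V := R_CompleteNormedModule) H h 0 (2 * PI)
  (fun t _ => dH t) (fun t _ => ch t).
by rewrite HE minus_eq_zero.
Qed.

Section Cauchy.

Variables (F F' : C -> C) (r : R) (a : C) (W : R -> C).
Hypotheses (hF : holomorphic F F') (r0 : 0 < r) (r1 : r < 1) (ar : Cmod a < r).
Hypotheses (cW : forall t, continuous W t)
  (WE : forall t, ((circle r t - a) * W t = circle r t)%C).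

Let path (s t : R) : C := (a + s * (circle r t - a))%C.

(* [0, 1] is contained in this open set of parameters, so two-sided derivatives in [s]
   make sense at both endpoints. *)
Let dom (s : R) := Rabs (1 - s) * Cmod a + Rabs s * r < 1.

Lemma path_disk s t : dom s -> disk (path s t).
Proof.
rewrite /dom /disk /path => ds; apply: Rle_lt_trans ds.
have -> : (a + s * (circle r t - a) = RtoC (1 - s) * a + s * circle r t)%C.
  by rewrite RtoC_minus; ring.
apply: Rle_trans (Cmod_triangle _ _) _.
by rewrite !Cmod_mult !Cmod_R Cmod_circle; lra.
Qed.

Lemma dom_unit s : 0 <= s <= 1 -> dom s.
Proof. by move=> s01; rewrite /dom !Rabs_pos_eq; [nra | lra | lra]. Qed.

Lemma dom_open s : dom s -> locally s dom.
Proof.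
move=> ds.
have c : continuous (fun s => Rabs (1 - s) * Cmod a + Rabs s * r) s.
  have cst x : continuous (fun _ : R => x) s by apply: continuous_const.
  have ci : continuous (fun x : R => x) s by apply: continuous_id.
  apply: (continuous_plus (V := R_NormedModule));
    apply: (continuous_mult (K := R_AbsRing)) => //.
    apply: (continuous_comp (fun x => 1 - x) Rabs); last exact: continuous_Rabs.
    exact: (continuous_minus (V := R_NormedModule)).
  exact: continuous_Rabs.
exact: (c (fun x => x < 1) (open_lt 1 _ ds)).
Qed.

Lemma path_continuous2 (p : R * R) : continuous (fun p : R * R => path p.1 p.2) p.
Proof.
apply: continuousC_plus; first exact: continuous_const.
apply: continuousC_mult.
  by apply: continuousC_RtoC; apply: continuous_fst.
apply: continuousC_minus; last exact: continuous_const.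
apply: (continuous_comp snd (circle r)); first exact: continuous_snd.
exact: continuous_circle.
Qed.

Lemma path_continuous s t : continuous (path s) t.
Proof.
apply: continuousC_plus; first exact: continuous_const.
apply: continuousC_mult; first exact: continuous_const.
apply: continuousC_minus; last exact: continuous_const.
exact: continuous_circle.
Qed.

Let G (s t : R) := Re (F (path s t) * W t).

Lemma G_continuous s t : dom s -> continuous (G s) t.
Proof.
move=> ds; rewrite /G.
suff : continuous (fun u => F (path s u) * W u)%C t by case/continuousCP.
apply: continuousC_mult => //; apply: (continuous_comp (path s) F).
  exact: path_continuous.
exact: cdiff_continuous (proj1 (hF (path_disk t ds))).
Qed.

(** Differentiating the path in [s] produces the factor [circle r t - a], which cancels the singular
    denominator hidden in [W]. *)
Lemma G_derive s t : dom s ->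
  is_derive (fun s => G s t) s (Re (F' (path s t) * circle r t)).
Proof.
move=> ds.
have := is_derive_cdiff (g := fun s => path s t) (v := circle r t - a)
  (proj1 (hF (path_disk t ds))) _ _ (W t).
rewrite -Cmult_assoc WE; apply.
- rewrite /path /=.
  by auto_derive => //; rewrite /Re /Im /=; ring.
- rewrite /path /=.
  by auto_derive => //; rewrite /Re /Im /=; ring.
Qed.

Lemma path_derive s t (H H' : C -> C) b :
  (forall z, disk z -> cdiff H z (H' z)) -> dom s ->
  is_derive (fun t => Re (H (path s t) * b)) t
    (Re (H' (path s t) * (s * (Ci * circle r t)) * b)).
Proof.
move=> hH ds.
apply: (is_derive_cdiff (g := path s)); first exact: hH (path_disk t ds).
- rewrite /path /= /Re /Im /=; auto_derive => //; ring.
- rewrite /path /= /Re /Im /=; auto_derive => //; ring.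
Qed.

(** For [s <> 0] the integrand is the real part of the [t]-derivative of [F (path s t)] divided by
    [Ci * s], and the path is closed. *)
Lemma is_RInt_circle_derive s : dom s ->
  is_RInt (fun t => Re (F' (path s t) * circle r t)) 0 (2 * PI) 0.
Proof.
move=> ds.
have cont t : continuous (fun t => Re (F' (path s t) * circle r t)) t.
  suff : continuous (fun t => F' (path s t) * circle r t)%C t by case/continuousCP.
  apply: continuousC_mult; last exact: continuous_circle.
  apply: (continuous_comp (path s) F'); first exact: path_continuous.
  exact: (proj2 (hF (path_disk t ds))).
(* At [s = 0] that division is impossible, but the integrand is [Re (F' a * circle r t)], whose
   primitive is a constant multiple of the full circle [path 1] up to a constant. *)
have [s0|s0] := Req_EM_T s 0.
  have ds1 : dom 1 by apply: dom_unit; lra.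
  apply: (is_RInt_closed (H := fun t => Re (path 1 t * (- Ci * F' a)))) => [t|t|] //.
    have := path_derive t (- Ci * F' a)%C (fun z _ => cdiff_id z) ds1.
    congr is_derive; congr Re.
    rewrite /path s0; transitivity (- (Ci * Ci) * (F' a * circle r t))%C; first by ring.
    by rewrite Ci2; have -> : (a + 0 * (circle r t - a) = a)%C; ring.
  by rewrite /path circle_2PI.
apply: (is_RInt_closed (H := fun t => Re (F (path s t) * (- Ci / s)))) => [t|t|] //.
  have := path_derive t (- Ci / s)%C (fun z dz => proj1 (hF dz)) ds.
  congr is_derive; congr Re.
  transitivity (- (Ci * Ci) * (F' (path s t) * circle r t))%C; last by rewrite Ci2; ring.
  by field => /RtoC_inj.
by rewrite /path circle_2PI.
Qed.

Lemma RInt_path_derive s : dom s -> is_derive (fun s => RInt (G s) 0 (2 * PI)) s 0.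
Proof.
move=> ds.
have D u t : dom u -> Derive (fun s => G s t) u = Re (F' (path u t) * circle r t).
  by move=> /(G_derive t) /is_derive_unique.
have E : RInt (fun t => Derive (fun u => G u t) s) 0 (2 * PI) = 0.
  rewrite (RInt_ext _ (fun t => Re (F' (path s t) * circle r t))).
    by rewrite (is_RInt_unique _ _ _ _ (is_RInt_circle_derive ds)).
  by move=> t _; apply: D.
rewrite -[X in is_derive _ _ X]E.
apply: is_derive_RInt_param.
- move: (dom_open ds); apply: filter_imp => u du t _.
  by eexists; apply: G_derive.
- move=> t _; apply/continuity_2d_pt_filterlim.
  change (continuous (fun p : R * R => Derive (fun u => G u p.2) p.1) (s, t)).
  (* The explicit formula for the derivative is available only for parameters in [dom]; openness of
     [dom] makes a local identification enough. *)
  apply: (continuous_ext_loc (T := prod_UniformSpace R_UniformSpace R_UniformSpace)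
     (U := R_UniformSpace) _
     (fun p : R * R => Re (F' (path p.1 p.2) * circle r p.2))).
    have : locally (s, t) (fun p : R * R => dom p.1).
      exact: (continuous_fst (s : R_UniformSpace) (t : R_UniformSpace) _ (dom_open ds)).
    by apply: filter_imp => p dp; rewrite D.
  suff : continuous (fun p : R * R => F' (path p.1 p.2) * circle r p.2)%C (s, t).
    by case/continuousCP.
  apply: continuousC_mult.
    apply: (continuous_comp (fun p : R * R => path p.1 p.2) F').
      exact: path_continuous2.
    exact: (proj2 (hF (path_disk t ds))).
  apply: (continuous_comp snd (circle r)); first exact: continuous_snd.
  exact: continuous_circle.
- move: (dom_open ds); apply: filter_imp => u du.
  by apply: (ex_RInt_continuous (V := R_CompleteNormedModule)) => t _; apply: G_continuous.
Qed.

(** The hypothesis [WE] makes [W] the Cauchy weight [zeta / (zeta - a)] on the circle. Leaving it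
    abstract allows both the constant 1, for [a = 0], and the conjugate of a Szego kernel. The
    integral over [path s] has zero derivative in [s], and the two sides are its values at 1 and
    0. *)
Lemma RInt_cauchy_weight :
  RInt (fun t => Re (F (circle r t) * W t)) 0 (2 * PI) =
  RInt (fun t => Re (F a * W t)) 0 (2 * PI).
Proof.
have dI s : 0 <= s <= 1 -> is_derive (fun s => RInt (G s) 0 (2 * PI)) s 0.
  by move=> /dom_unit; apply: RInt_path_derive.
have [s|s|c [_]] := MVT_gen (fun s => RInt (G s) 0 (2 * PI)) 0 1 (fun=> 0).
- by rewrite Rmin_left ?Rmax_right => *; try apply: dI; lra.
- rewrite Rmin_left ?Rmax_right => *; try lra.
  apply/continuity_pt_filterlim.
  have ex : ex_derive (fun s => RInt (G s) 0 (2 * PI)) s by exists 0; apply: dI.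
  exact: (ex_derive_continuous _ _ ex).
rewrite Rmult_0_l => E.
have -> : RInt (fun t => Re (F (circle r t) * W t)) 0 (2 * PI) = RInt (G 1) 0 (2 * PI).
  by apply: RInt_ext => t _; rewrite /G /path; congr Re; congr (F _ * _)%C; ring.
have -> : RInt (fun t => Re (F a * W t)) 0 (2 * PI) = RInt (G 0) 0 (2 * PI).
  by apply: RInt_ext => t _; rewrite /G /path; congr Re; congr (F _ * _)%C; ring.
lra.
Qed.

End Cauchy.

(** * Closure properties of holomorphic functions *)

Lemma holomorphic_ext (A : C -> Prop) F G F' : (forall z, F z = G z) ->
  holomorphic_on A F F' -> holomorphic_on A G F'.
Proof.
move=> FG hF z /hF [dF cF]; split=> //; apply: cdiff_ext_loc dF.
exact: filter_forall.
Qed.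

Lemma holomorphic_const (A : C -> Prop) c : holomorphic_on A (fun=> c) (fun=> RtoC 0).
Proof. by move=> z _; split; [apply: cdiff_const | apply: continuous_const]. Qed.

Lemma holomorphic_plus (A : C -> Prop) F G F' G' : holomorphic_on A F F' -> holomorphic_on A G G' ->
  holomorphic_on A (fun x => F x + G x)%C (fun x => F' x + G' x)%C.
Proof.
move=> hF hG z dz; have [dF cF] := hF z dz; have [dG cG] := hG z dz.
by split; [apply: cdiff_plus | apply: continuousC_plus].
Qed.

Lemma holomorphic_mult (A : C -> Prop) F G F' G' : holomorphic_on A F F' -> holomorphic_on A G G' ->
  holomorphic_on A (fun x => F x * G x)%C (fun x => F' x * G x + F x * G' x)%C.
Proof.
move=> hF hG z dz; have [dF cF] := hF z dz; have [dG cG] := hG z dz.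
split; first exact: cdiff_mult.
by apply: continuousC_plus; apply: continuousC_mult => //; apply: cdiff_continuous; eassumption.
Qed.

Lemma holomorphic_inv (A : C -> Prop) F F' : holomorphic_on A F F' ->
  (forall z, A z -> F z <> RtoC 0) ->
  holomorphic_on A (fun x => / F x)%C (fun x => - (F' x / (F x * F x)))%C.
Proof.
move=> hF F0 z dz; have [dF cF] := hF z dz; have Fz := F0 z dz.
split; first exact: cdiff_inv.
have c := cdiff_continuous dF.
apply: continuousC_opp; apply: continuousC_mult => //; apply: continuousC_inv.
  exact: continuousC_mult.
exact: Cmult_neq_0.
Qed.

Lemma holomorphic_id (A : C -> Prop) : holomorphic_on A (fun x => x) (fun=> RtoC 1).
Proof. by move=> z _; split; [apply: cdiff_id | apply: continuous_const]. Qed.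

(* With [s = 1 / r ^ 2] this is the Szego kernel of the circle of radius [r]. *)
Definition szego (s : R) (a z : C) : C := (/ (1 - s * (Cconj a * z)))%C.

Lemma Cmod_lt1_neq0 (u : C) : Cmod u < 1 -> (1 - u)%C <> RtoC 0.
Proof. by move=> u1 E; move: u1; rewrite -(Cminus_eq0 E) Cmod_1; lra. Qed.

Lemma szego_neq0 s a z : 0 <= s -> s * Cmod a < 1 -> disk z ->
  (1 - s * (Cconj a * z))%C <> RtoC 0.
Proof.
move=> s0 sa dz; apply: Cmod_lt1_neq0; rewrite !Cmod_mult Cmod_conj Cmod_R Rabs_pos_eq //.
have := Cmod_ge_0 z; have := Cmod_ge_0 a; rewrite /disk in dz; nra.
Qed.

Lemma holomorphic_szego s a : 0 <= s -> s * Cmod a < 1 ->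
  exists k, holomorphic (szego s a) k.
Proof.
move=> s0 sa.
have h1 := holomorphic_mult (holomorphic_const (A := disk) (- (s * Cconj a)))
  (@holomorphic_id disk).
have h2 := holomorphic_plus (holomorphic_const 1) h1.
eexists; apply: holomorphic_inv; last by move=> z; apply: szego_neq0.
by apply: holomorphic_ext h2 => z; ring.
Qed.

(** * The reproducing property of the Szego kernels *)

Lemma RInt_circle_mean F F' r : holomorphic F F' -> 0 < r < 1 ->
  RInt (fun t => Re (F (circle r t))) 0 (2 * PI) = 2 * PI * Re (F 0).
Proof.
move=> hF [r0 r1].
have a0 : Cmod 0 < r by rewrite Cmod_0.
have c1 t : continuous (fun _ : R => RtoC 1) t by apply: continuous_const.
have E1 t : ((circle r t - 0) * 1 = circle r t)%C by ring.
have := RInt_cauchy_weight hF r0 r1 a0 c1 E1.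
rewrite (RInt_ext _ (fun t => Re (F (circle r t)))) => [->|t _].
  by rewrite Cmult_1_r RInt_const /scal /= /mult /=; ring.
by rewrite Cmult_1_r.
Qed.

(** On the circle [Cconj zeta = r ^ 2 / zeta], so the conjugate of [1 - Cconj a * zeta / r ^ 2] is
    [(zeta - a) / zeta]: the conjugated kernel is the Cauchy weight. *)
Lemma szego_circle r a t : 0 < r < 1 -> Cmod a < r * r ->
  ((circle r t - a) * Cconj (szego (/ (r * r)) a (circle r t)) = circle r t)%C.
Proof.
move=> [r0 r1] ar; rewrite /szego.
have ic : 0 < / (r * r) by apply: Rinv_0_lt_compat; nra.
have sa : / (r * r) * Cmod a < 1.
  by apply: (Rmult_lt_reg_l (r * r)); first nra; rewrite -Rmult_assoc Rinv_r; nra.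
have dc : disk (circle r t) by rewrite /disk Cmod_circle; lra.
have n0 := szego_neq0 (Rlt_le _ _ ic) sa dc.
have n1 : Cconj (1 - (/ (r * r)) %R * (Cconj a * circle r t))%C <> RtoC 0.
  by move=> E; apply: n0; rewrite -[LHS]Cconj_conj E /Cconj /= Ropp_0.
rewrite Cinv_conj //.
have E : (circle r t - a = circle r t * Cconj (1 - (/ (r * r))%R * (Cconj a * circle r t)))%C.
  rewrite Cminus_conj !Cmult_conj Cconj_conj.
  have cc : (circle r t * Cconj (circle r t) = RtoC (r * r))%C.
    by rewrite -Cmod2_conj Cmod_circle; [congr RtoC; ring | lra].
  have c1 : Cconj 1 = 1%C by rewrite /Cconj /= Ropp_0.
  have c2 : Cconj (/ (r * r))%R = RtoC (/ (r * r)) by rewrite /Cconj /= Ropp_0.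
  rewrite c1 c2.
  transitivity (circle r t - (/ (r * r))%R * (circle r t * Cconj (circle r t)) * a)%C; last by ring.
  rewrite cc -RtoC_mult Rinv_l; last by nra.
  by ring.
by rewrite {1}E -Cmult_assoc Cinv_r // Cmult_1_r.
Qed.

(** The condition [Cmod a < r * r], stronger than [a] lying inside the circle, makes the kernel
    holomorphic on the whole unit disk. *)
Lemma is_RInt_szego F F' r a : holomorphic F F' -> 0 < r < 1 -> Cmod a < r * r ->
  is_RInt (fun t => Re (F (circle r t) * Cconj (szego (/ (r * r)) a (circle r t)))) 0 (2 * PI)
    (2 * PI * Re (F a)).
Proof.
move=> hF [r0 r1] ar.
have ic : 0 < / (r * r) by apply: Rinv_0_lt_compat; nra.
have sa : / (r * r) * Cmod a < 1.
  by apply: (Rmult_lt_reg_l (r * r)); first nra; rewrite -Rmult_assoc Rinv_r; nra.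
have [k' hk] := holomorphic_szego (Rlt_le _ _ ic) sa.
have dc t : disk (circle r t) by rewrite /disk Cmod_circle; lra.
pose W t := Cconj (szego (/ (r * r)) a (circle r t)).
have cW t : continuous W t.
  apply: continuousC_conj; apply: (continuous_comp (circle r)); first exact: continuous_circle.
  by apply: cdiff_continuous; apply: (proj1 (hk _ (dc t))).
have cFW t : continuous (fun t => Re (F (circle r t) * W t)) t.
  suff : continuous (fun t => F (circle r t) * W t)%C t by case/continuousCP.
  apply: continuousC_mult => //; apply: (continuous_comp (circle r)).
    exact: continuous_circle.
  by apply: cdiff_continuous; apply: (proj1 (hF _ (dc t))).
have ar' : Cmod a < r by nra.
have WE t := szego_circle t (conj r0 r1) ar.
have E := RInt_cauchy_weight hF r0 r1 ar' cW WE.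
have -> : 2 * PI * Re (F a) = RInt (fun t => Re (F (circle r t) * W t)) 0 (2 * PI).
  rewrite E.
  (* What remains is the integral of [Re (F a * W t)]. Conjugation turns it into the mean of a
     holomorphic function, evaluated at the centre, where the kernel equals 1. *)
  have h := holomorphic_mult (holomorphic_const (Cconj (F a))) hk.
  have := RInt_circle_mean h (conj r0 r1).
  rewrite {2}/szego.
  have -> : Re (Cconj (F a) * / (1 - RtoC (/ (r * r)) * (Cconj a * 0))) = Re (F a).
    have -> : (1 - RtoC (/ (r * r)) * (Cconj a * 0) = RtoC 1)%C by ring.
    have -> : (/ RtoC 1 = RtoC 1)%C by field.
    by rewrite Cmult_1_r re_conj.
  move=> <-; apply: RInt_ext => t _.
  by rewrite -[LHS]re_conj Cmult_conj Cconj_conj.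
apply: RInt_correct; apply: (ex_RInt_continuous (V := R_CompleteNormedModule)) => t _.
exact: cFW.
Qed.

(** * Pick's inequality *)

HB.instance Definition _ := Monoid.isComLaw.Build C (RtoC 0) Cplus
  Cplus_assoc Cplus_comm Cplus_0_l.

Notation "\csum_ i F" := (\big[Cplus/RtoC 0]_i F%C)
  (at level 41, i at level 0, F at level 41).

Lemma csum_distrr (I : finType) (c : C) (F : I -> C) :
  (c * (\csum_i F i))%C = \csum_i (c * F i).
Proof. by apply: (big_morph (Cmult c)) => [x y|]; ring. Qed.

Lemma csum_conj (I : finType) (F : I -> C) :
  Cconj (\csum_i F i) = \csum_i Cconj (F i).
Proof. by apply: (big_morph Cconj Cplus_conj); rewrite /Cconj /= Ropp_0. Qed.

Lemma holomorphic_sum (I : finType) (F : I -> C -> C) :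
  (forall i, exists F', holomorphic (F i) F') ->
  exists S', holomorphic (fun z => \csum_i F i z) S'.
Proof.
move=> hF; elim: (index_enum I) => [|i s [S' hS]].
  exists (fun=> RtoC 0).
  by apply: holomorphic_ext (holomorphic_const 0) => z; rewrite big_nil.
have [F' hi] := hF i; exists (fun z => F' z + S' z)%C.
by apply: holomorphic_ext (holomorphic_plus hi hS) => z; rewrite big_cons.
Qed.

Lemma continuous_csum (I : finType) (U : UniformSpace) (F : I -> U -> C) x :
  (forall i, continuous (F i) x) -> continuous (fun y => \csum_i F i y) x.
Proof.
move=> cF; elim: (index_enum I) => [|i s IH].
  by apply: continuous_ext (continuous_const (RtoC 0) x) => y; rewrite big_nil.
apply: (continuous_ext (fun y => F i y + \big[Cplus/RtoC 0]_(j <- s) F j y)%C) => [y|].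
  by rewrite big_cons.
exact: continuousC_plus.
Qed.

Lemma is_RInt_Re_sum (I : finType) (f : I -> R -> C) (v : I -> C) a b p :
  (forall i, is_RInt (fun t => Re (f i t)) a b (p * Re (v i))) ->
  is_RInt (fun t => Re (\csum_i f i t)) a b (p * Re (\csum_i v i)).
Proof.
move=> hf; elim: (index_enum I) => [|i s IH].
  rewrite big_nil Rmult_0_r.
  have h : is_RInt (fun _ : R => 0) a b ((b - a) * 0) by apply: is_RInt_const.
  rewrite Rmult_0_r in h.
  by apply: is_RInt_ext h => t _; rewrite big_nil.
rewrite big_cons re_plus Rmult_plus_distr_l.
apply: (is_RInt_ext (fun t => Re (f i t) + Re (\big[Cplus/RtoC 0]_(j <- s) f j t))).
  by move=> t _; rewrite big_cons.
exact: (is_RInt_plus (V := R_NormedModule)).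
Qed.

Section Pick.

Variables (n : nat) (z : 'I_n -> C).

Definition kernel_sum (s : R) (c : 'I_n -> C) (u : C) : C :=
  \csum_j (c j * szego s (z j) u).

(** For [s = 1 / r ^ 2] and nodes of modulus below [r ^ 2], the reproducing property makes this the
    mean of [|kernel_sum s c| ^ 2] over the circle of radius [r]. At [s = 1] it is the form of the
    matrix [1 / (1 - z i * Cconj (z j))]. *)
Definition kernel_form (s : R) (c : 'I_n -> C) : R :=
  Re (\csum_i (Cconj (c i) * kernel_sum s c (z i))).

Variable r : R.
Hypotheses (r01 : 0 < r < 1) (zr : forall i, Cmod (z i) < r * r).

Let s := / (r * r).

Lemma holomorphic_kernel_sum c : exists k, holomorphic (kernel_sum s c) k.
Proof.
case: r01 => r0 r1; apply: holomorphic_sum => i.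
have ic : 0 < s by apply: Rinv_0_lt_compat; nra.
have sa : s * Cmod (z i) < 1.
  apply: (Rmult_lt_reg_l (r * r)); first nra.
  by rewrite -Rmult_assoc Rinv_r; [have := zr i; nra | nra].
have [k hk] := holomorphic_szego (Rlt_le _ _ ic) sa.
by eexists; apply: (holomorphic_mult (holomorphic_const (c i)) hk).
Qed.

Lemma is_RInt_kernel_sum F F' c : holomorphic F F' ->
  is_RInt (fun t => Re (F (circle r t) * Cconj (kernel_sum s c (circle r t)))) 0 (2 * PI)
    (2 * PI * Re (\csum_i (Cconj (c i) * F (z i)))).
Proof.
move=> hF.
apply: (is_RInt_ext (fun t => Re (\csum_i (Cconj (c i) * F (circle r t) *
    Cconj (szego s (z i) (circle r t)))))).
  move=> t _; congr Re; rewrite /kernel_sum csum_conj csum_distrr.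
  by apply: eq_bigr => i _; rewrite Cmult_conj; ring.
apply: is_RInt_Re_sum => i.
exact: (is_RInt_szego (holomorphic_mult (holomorphic_const (Cconj (c i))) hF) r01 (zr i)).
Qed.

(* Integrate [|K - h L|^2 >= 0] over the circle, where [K] and [L] are the kernel
   sums of [c] and [d]: by the reproducing property [<h L, K> = |L|^2]. *)
Lemma pick_circle h h' B (c d : 'I_n -> C) : holomorphic h h' ->
  (forall t, Cmod (h (circle r t)) ^ 2 <= B) ->
  (forall i, (Cconj (d i) = Cconj (c i) * h (z i))%C) ->
  0 <= kernel_form s c + (B - 2) * kernel_form s d.
Proof.
move=> hh hB dE.
have [k hK] := holomorphic_kernel_sum c.
have [l hL] := holomorphic_kernel_sum d.
have IK := is_RInt_kernel_sum (c := c) hK.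
have IL := is_RInt_kernel_sum (c := d) hL.
have IhL := is_RInt_kernel_sum (c := c) (holomorphic_mult hh hL).
have E : \csum_i (Cconj (c i) * (h (z i) * kernel_sum s d (z i))) =
         \csum_i (Cconj (d i) * kernel_sum s d (z i)).
  by apply: eq_bigr => i _; rewrite dE; ring.
rewrite {}E in IhL.
(* The factors [-2] and [B] come from [|K - h L|^2 <= |K|^2 - 2 Re (h L Cconj K) + B |L|^2]. *)
have I1 := is_RInt_scal (V := R_NormedModule) _ _ _ (-2) _ IhL.
have I2 := is_RInt_scal (V := R_NormedModule) _ _ _ B _ IL.
have I3 := is_RInt_plus (V := R_NormedModule) _ _ _ _ _ _ IK I1.
have := is_RInt_plus (V := R_NormedModule) _ _ _ _ _ _ I3 I2.
set v := plus _ _.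
have -> : v = 2 * PI * (kernel_form s c + (B - 2) * kernel_form s d).
  by rewrite /v /kernel_form /plus /scal /= /mult /=; ring.
move=> I; have pi0 := PI_RGT_0.
suff : 0 <= 2 * PI * (kernel_form s c + (B - 2) * kernel_form s d) by nra.
have pi2 : 0 <= 2 * PI by lra.
rewrite -(is_RInt_unique _ _ _ _ I).
apply: RInt_ge_0 => //; first by eexists; exact: I.
move=> t _; rewrite /plus /scal /= /mult /=.
set K := kernel_sum s c _; set L := kernel_sum s d _.
have {hB} := hB t; set H := h _; rewrite !Cmod2_alt.
rewrite /Re /Im /=.
have := Rle_0_sqr (K.1 - (H.1 * L.1 - H.2 * L.2)).
have := Rle_0_sqr (K.2 - (H.1 * L.2 + H.2 * L.1)).
have := Rle_0_sqr L.1; have := Rle_0_sqr L.2; rewrite /Rsqr => l2 l1 k2 k1 hB.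
(* Pointwise, the integrand is [|K - H L|^2 + (B - |H|^2) |L|^2]. *)
have : 0 <= (B - (H.1 * (H.1 * 1) + H.2 * (H.2 * 1))) * (L.1 * L.1 + L.2 * L.2).
  by apply: Rmult_le_pos; lra.
nra.
Qed.

End Pick.

Lemma disk_bound n (z : 'I_n -> C) : (forall i, disk (z i)) ->
  exists2 rho, 0 <= rho < 1 & forall i, Cmod (z i) <= rho.
Proof.
move=> dz; suff [rho r01 h] : exists2 rho, 0 <= rho < 1 &
    forall i, i \in enum 'I_n -> Cmod (z i) <= rho.
  by exists rho => // i; apply: h; rewrite mem_enum.
elim: (enum 'I_n) => [|i s [rho r01 IH]]; first by exists 0; [lra|].
exists (Rmax rho (Cmod (z i))).
  have := dz i; rewrite /disk => d; split; last by apply: Rmax_lub_lt; lra.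
  by apply: Rle_trans (Rmax_l _ _); lra.
move=> j; rewrite inE => /orP[/eqP->|/IH h]; first exact: Rmax_r.
exact: Rle_trans h (Rmax_l _ _).
Qed.

Lemma continuous_kernel_form n (z : 'I_n -> C) c s : (forall i, disk (z i)) ->
  0 <= s <= 1 -> continuous (fun s => kernel_form z s c) s.
Proof.
move=> dz [s0 s1]; rewrite /kernel_form /kernel_sum.
suff : continuous (fun s => \csum_i (Cconj (c i) * (\csum_j (c j * szego s (z j) (z i))))) s.
  by case/continuousCP.
apply: continuous_csum => i; apply: continuousC_mult; first exact: continuous_const.
apply: continuous_csum => j; apply: continuousC_mult; first exact: continuous_const.
apply: continuousC_inv; last first.
  by apply: szego_neq0 => //; have := dz j; rewrite /disk; have := Cmod_ge_0 (z j); nra.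
apply: continuousC_minus; first exact: continuous_const.
apply: continuousC_mult; last exact: continuous_const.
by apply: continuousC_RtoC; apply: continuous_id.
Qed.

(** With [s = 1 / r ^ 2] the circle inequality has coefficient [s ^ m - 2], equal to -1 at [s = 1].
    By continuity a strict failure at [s = 1] would persist for [r] slightly below 1. *)
Lemma kernel_form_le h h' m n (z c d : 'I_n -> C) : holomorphic h h' ->
  (forall r t, 0 < r < 1 -> Cmod (h (circle r t)) ^ 2 <= (/ (r * r)) ^ m) ->
  (forall i, disk (z i)) ->
  (forall i, (Cconj (d i) = Cconj (c i) * h (z i))%C) ->
  kernel_form z 1 d <= kernel_form z 1 c.
Proof.
move=> hh hB dz dE.
have [rho r01 zr] := disk_bound dz.
pose P s := kernel_form z s c + (s ^ m - 2) * kernel_form z s d.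
have P1 : P 1 = kernel_form z 1 c - kernel_form z 1 d by rewrite /P pow1; ring.
have cP : continuous P 1.
  have c1 x : continuous (fun _ : R => x) 1 by apply: continuous_const.
  apply: (continuous_plus (V := R_NormedModule)); first by apply: continuous_kernel_form; [|lra].
  apply: (continuous_mult (K := R_AbsRing)); last by apply: continuous_kernel_form; [|lra].
  apply: (continuous_minus (V := R_NormedModule)) => //.
  elim: m {hB P P1} => [|m IH]; first exact: c1.
  by apply: (continuous_mult (K := R_AbsRing)) => //; apply: continuous_id.
have cr : continuous (fun r => P (/ (r * r))) 1.
  apply: (continuous_comp (fun r => / (r * r)) P); last by rewrite Rmult_1_r Rinv_1.
  apply: continuous_comp; last by apply: continuous_Rinv; lra.
  by apply: (continuous_mult (K := R_AbsRing)); apply: continuous_id.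
apply: Rnot_lt_le => lt; have P10 : P (/ (1 * 1)) < 0 by rewrite Rmult_1_r Rinv_1 P1; lra.
have [e E] : locally 1 (fun r => P (/ (r * r)) < 0).
  exact: (cr (fun x => x < 0) (open_lt 0 _ P10)).
(* The square of [(1 + rho) / 2] exceeds [rho], which puts all nodes below [r * r]; the other bound
   keeps [r] within [e] of 1. *)
pose r := Rmax ((1 + rho) / 2) (1 - e / 2).
have e0 := cond_pos e.
have r1 : r < 1 by apply: Rmax_lub_lt; lra.
have rl : (1 + rho) / 2 <= r by apply: Rmax_l.
have re : 1 - e / 2 <= r by apply: Rmax_r.
have r0 : 0 < r < 1 by lra.
have zrr i : Cmod (z i) < r * r by apply: Rle_lt_trans (zr i) _; nra.
have := pick_circle r0 zrr hh (fun t => hB r t r0) dE.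
have : P (/ (r * r)) < 0.
  apply: E; rewrite /ball /= /AbsRing_ball /abs /minus /plus /opp /=.
  by rewrite Rabs_left1; lra.
by rewrite /P; lra.
Qed.

Lemma kernel_form_1 n (z c : 'I_n -> C) :
  kernel_form z 1 c =
  Re (\csum_i \csum_j (Cconj (c i) * c j / (1 - z i * Cconj (z j)))).
Proof.
congr Re; apply: eq_bigr => i _; rewrite csum_distrr; apply: eq_bigr => j _.
by rewrite /szego /Cdiv Cmult_assoc; congr (_ * / (_ - _))%C; ring.
Qed.

(** * Factoring out the zero at the origin *)

(** Passing to the canonical derivative [C_derive u] lets different local formulas for the same
    function be glued. *)
Lemma holomorphic_C_derive (A : C -> Prop) u v v' :
  (forall z, A z -> locally z A) -> (forall z, A z -> u z = v z) ->
  holomorphic_on A v v' -> holomorphic_on A u (C_derive u).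
Proof.
move=> oA uv hv z Az.
have du x : A x -> cdiff u x (v' x).
  move=> Ax; apply: cdiff_ext_loc (proj1 (hv x Ax)).
  by move: (oA x Ax); apply: filter_imp => y /uv.
rewrite (cdiff_C_derive (du z Az)); split; first exact: du.
apply: continuous_ext_loc (proj2 (hv z Az)).
by move: (oA z Az); apply: filter_imp => x Ax; rewrite (cdiff_C_derive (du x Ax)).
Qed.

Lemma cdiff_shift g z a d : cdiff g (z - a)%C d -> cdiff (fun x => g (x - a)%C) z d.
Proof.
move=> [p [pc <- pE]].
have ca : continuous (fun x : C => x - a)%C z.
  by apply: continuousC_minus; [apply: continuous_id | apply: continuous_const].
exists (fun x => p (x - a)%C); split => //; first exact: continuous_comp.
have : locally z (fun x => (g (x - a) - g (z - a) = p (x - a) * (x - a - (z - a)))%C).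
  exact: (ca _ pE).
by apply: filter_imp => x ->; congr (_ * _)%C; ring.
Qed.

Lemma ball_open (a : C) r z : Cmod (z - a) < r -> locally z (fun x => Cmod (x - a) < r).
Proof.
move=> zr; have d0 : 0 < r - Cmod (z - a) by lra.
apply: (locallyC_Cmod d0) => x xz; have := Cmod_triangle (x - z) (z - a).
have -> : (x - z + (z - a) = x - a)%C by ring.
by lra.
Qed.

Lemma disk_open z : disk z -> locally z disk.
Proof.
move=> dz; have z0 x : (x - 0 = x)%C by ring.
have := @ball_open 0 1 z; rewrite z0 => /(_ dz).
by apply: filter_imp => x; rewrite z0.
Qed.

Lemma holomorphic_cps c r f a : (forall z, Cmod (z - a) < r -> cps c (z - a) (f z)) ->
  holomorphic_on (fun z => Cmod (z - a) < r) f (C_derive f).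
Proof.
move=> fc; pose g u := f (a + u)%C.
have gc u : Cmod u < r -> cps c u (g u).
  by move=> ur; have := fc (a + u)%C; have -> : (a + u - a = u)%C; [ring | apply].
apply: (holomorphic_C_derive (v := fun z => g (z - a)%C) (v' := fun z => C_derive g (z - a)%C)).
- exact: ball_open.
- by move=> z _; rewrite /g; congr f; ring.
move=> z zr; split; first exact: cdiff_shift (proj2 (cps_derive gc zr)).
have gc' u : Cmod u < r -> cps (dps c) u (C_derive g u) by move=> /(cps_derive gc) [].
apply: (continuous_comp (fun z => z - a)%C (C_derive g)).
  by apply: continuousC_minus; [apply: continuous_id | apply: continuous_const].
exact: cdiff_continuous (proj2 (cps_derive gc' zr)).
Qed.

Lemma holomorphic_analytic f : analytic_on_disk f -> holomorphic f (C_derive f).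
Proof.
move=> af a /af [c [r [r0 fc]]].
apply: (@holomorphic_cps c r f a) => [z zr|]; first by apply/cpsE; apply: fc.
by have -> : (a - a = 0)%C; [ring | rewrite Cmod_0].
Qed.

Lemma Cconj_RtoC (x : R) : Cconj x = x.
Proof. by rewrite /Cconj /= Ropp_0. Qed.

Lemma mobius_factor f m lambda : (0 < m)%nat -> analytic_on_disk f ->
  (forall z, disk z -> Cmod (f z) <= 1) ->
  (forall k, (0 < k < m)%nat -> iter k C_derive f 0 = 0) ->
  f 0 = lambda -> disk lambda ->
  exists h h', [/\ holomorphic h h',
    forall z, disk z -> (z ^ m * h z = mobius lambda (f z))%C
    & forall r t, 0 < r < 1 -> Cmod (h (circle r t)) ^ 2 <= (/ (r * r)) ^ m].
Proof.
move=> m0 af f1 fk f0 dl.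
have d0 : disk 0 by rewrite /disk Cmod_0; lra.
have n0 z : disk z -> (1 - Cconj lambda * f z)%C <> RtoC 0.
  move=> /f1 fz; apply: Cmod_lt1_neq0; rewrite Cmod_mult Cmod_conj.
  by have := Cmod_ge_0 (f z); have := Cmod_ge_0 lambda; rewrite /disk in dl; nra.
have [c [r [r0 fc]]] := af 0 d0.
have {}fc z : Cmod z < r -> cps c z (f z).
  have E : (z - 0 = z)%C by ring.
  by move=> zr; have := fc z; rewrite E => /(_ zr) /cpsE.
have ck k : (0 < k < m)%nat -> c k = 0.
  move=> km; have := fk k km; rewrite (cps_iter_derive k r0 fc) => E.
  have F0 : INR (Factorial.fact k) <> 0 by apply: INR_fact_neq_0.
  have -> : c k = (INR (Factorial.fact k) * c k / INR (Factorial.fact k))%C.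
    by field => /RtoC_inj.
  by rewrite E; field => /RtoC_inj.
have c0 : c O = lambda.
  by have := cps_iter_derive O r0 fc; rewrite /= f0 => ->; ring.
(* The value [c m] at 0 is the constant term of the shifted series. The factor [h] will be
   [u / (1 - Cconj lambda * f)]. *)
pose u z := if Req_EM_T (Cmod z) 0 then c m else ((f z - lambda) / z ^ m)%C.
have u0 : u 0 = c m by rewrite /u Cmod_0; case: Req_EM_T.
have uE z : z <> RtoC 0 -> u z = ((f z - lambda) / z ^ m)%C.
  by move=> z0; rewrite /u; case: Req_EM_T => // E; case: z0; apply: Cmod_eq_0.
have uz z : (z ^ m * u z)%C = (f z - lambda)%C \/ z = 0.
  have [/Cmod_eq_0 z0|z0] := Req_EM_T (Cmod z) 0; first by right.
  left; rewrite uE => [|E]; last by apply: z0; rewrite E Cmod_0.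
  by field; apply: Cpow_nz => E; apply: z0; rewrite E Cmod_0.
have uc z : Cmod (z - 0) < r -> cps (fun k => c (m + k)%nat) (z - 0) (u z).
  have -> : (z - 0 = z)%C by ring.
  move=> zr; have [/Cmod_eq_0 ->|z0] := Req_EM_T (Cmod z) 0.
    by rewrite u0 -[X in c X]addn0; apply: cps_0.
  have z1 : z <> RtoC 0 by move=> E; apply: z0; rewrite E Cmod_0.
  by rewrite uE // -c0; apply: cps_shift => //; apply: fc.
have hu0 := holomorphic_cps uc.
have hf := holomorphic_analytic af.
(* At 0 the shifted series applies; elsewhere, the quotient formula on the punctured disk. *)
have hu : holomorphic u (C_derive u).
  move=> z dz; have [/Cmod_eq_0 z0|z0] := Req_EM_T (Cmod z) 0.
    by apply: hu0; rewrite z0; have -> : (0 - 0 = 0)%C; [ring | rewrite Cmod_0].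
  pose A z := disk z /\ z <> RtoC 0.
  have sA F F' : holomorphic F F' -> holomorphic_on A F F' by move=> hF x [dx _]; apply: hF.
  have hp k : exists p, holomorphic_on A (fun x => x ^ k)%C p.
    elim: k => [|k [p hp]]; first by eexists; apply: (holomorphic_const 1).
    by eexists; apply: (holomorphic_mult (@holomorphic_id A) hp).
  have [p {}hp] := hp m.
  have h1 := holomorphic_inv hp (fun x Ax => Cpow_nz x m (proj2 Ax)).
  have h2 := holomorphic_mult (holomorphic_plus (sA _ _ hf) (holomorphic_const (- lambda))) h1.
  apply: (holomorphic_C_derive (A := A) _ _ h2).
  - move=> x [dx x0]; apply: filter_and.
      exact: disk_open.
    exact: (continuousC_neq0 (continuous_id x)).
  - by move=> x [_ /uE].
  - by split => // E; apply: z0; rewrite E Cmod_0.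
have hq := holomorphic_plus (holomorphic_const 1)
  (holomorphic_mult (holomorphic_const (- Cconj lambda)) hf).
have hh := holomorphic_mult hu (holomorphic_inv hq _).
eexists; eexists; split.
- apply: hh => z dz.
  by have -> : (1 + - Cconj lambda * f z = 1 - Cconj lambda * f z)%C; [ring | apply: n0].
- move=> z dz /=; rewrite Cmult_assoc /mobius.
  have -> : (1 + - Cconj lambda * f z = 1 - Cconj lambda * f z)%C by ring.
  congr (_ * _)%C; case: (uz z) => // ->; rewrite f0 -(prednK m0) /=; ring.
move=> r' t [r0' r1']; cbv beta.
have cr : Cmod (circle r' t) = r' by rewrite Cmod_circle; lra.
have dc : disk (circle r' t) by rewrite /disk cr.
set x := circle r' t in cr dc *.
have x0 : x <> RtoC 0 by move=> E; move: cr; rewrite E Cmod_0; lra.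
rewrite uE //.
have -> : (1 + - Cconj lambda * f x = 1 - Cconj lambda * f x)%C by ring.
have nx := n0 x dc; have xm := Cpow_nz x m x0.
have -> : ((f x - lambda) / x ^ m * / (1 - Cconj lambda * f x) =
    (f x - lambda) / (x ^ m * (1 - Cconj lambda * f x)))%C.
  by field.
rewrite Cmod_div; last exact: Cmult_neq_0.
rewrite Cmod_mult Cmod_pow cr.
(* The difference of the two sides is [(1 - |lambda|^2) (1 - |f x|^2)]. *)
have : Cmod (f x - lambda) ^ 2 <= Cmod (1 - Cconj lambda * f x) ^ 2.
  have := f1 x dc; have := Cmod_ge_0 (f x); rewrite /disk in dl; have := Cmod_ge_0 lambda.
  have fx2 := Cmod2_alt (f x); have l2 := Cmod2_alt lambda.
  move=> l0 F0 F1.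
  have F2 : Cmod (f x) ^ 2 <= 1 by nra.
  have L2 : Cmod lambda ^ 2 <= 1 by nra.
  move: F2 L2; rewrite fx2 l2 !Cmod2_alt /Re /Im /=; nra.
set P := Cmod (f x - lambda); set Q := Cmod (1 - _) => PQ.
have Q0 : 0 < Q by apply/Cmod_gt_0.
have rm : 0 < r' ^ m by apply: pow_lt.
have -> : (/ (r' * r')) ^ m = Q ^ 2 / (r' ^ m * Q) ^ 2.
  rewrite pow_inv Rpow_mult_distr; field; split; lra.
have -> : (P / (r' ^ m * Q)) ^ 2 = P ^ 2 / (r' ^ m * Q) ^ 2 by field; split; lra.
apply: Rmult_le_compat_r => //; apply: Rlt_le; apply: Rinv_0_lt_compat.
by apply: pow_lt; nra.
Qed.

(* The 2 x 2 Pick matrix at [0] and [a] has diagonal entry [1 - |f 0| ^ 2]. *)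
Lemma bounded_disk_at0 f a : analytic_on_disk f ->
  (forall z, disk z -> Cmod (f z) <= 1) -> disk a -> disk (f a) -> disk (f 0).
Proof.
move=> af f1 da dfa.
have d0 : disk 0 by rewrite /disk Cmod_0; lra.
have [//|f0] := Rlt_le_dec (Cmod (f 0)) 1.
have {}f0 : Cmod (f 0) = 1 by have := f1 0 d0; lra.
pose q := (1 - f 0 * Cconj (f a))%C.
have q0 : 0 < Cmod q.
  apply/Cmod_gt_0; apply: Cmod_lt1_neq0; rewrite Cmod_mult Cmod_conj f0.
  by rewrite /disk in dfa; lra.
(* If [|f 0| = 1], the Pick matrix has rows [(0, q)] and [(Cconj q, M)] with [q <> 0] and [M > 0].
   On the vector [(- N q, 1)] with [N = M / |q|^2] its form equals [- 2 N |q|^2 + M = - M < 0], a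
   contradiction. *)
pose M := (1 - Cmod (f a) ^ 2) / (1 - Cmod a ^ 2).
pose z (i : 'I_2) : C := if i == ord0 then RtoC 0 else a.
pose c (i : 'I_2) : C := if i == ord0 then (- (M / Cmod q ^ 2)%R * q)%C else RtoC 1.
have dz i : disk (z i) by rewrite /z; case: ifP.
(* The inequality is applied to [f] itself with exponent 0, for which the bound reads
   [|f|^2 <= 1]. *)
have hB r t : 0 < r < 1 -> Cmod (f (circle r t)) ^ 2 <= (/ (r * r)) ^ 0.
  move=> [r0 r1]; rewrite /=; have := f1 (circle r t); rewrite /disk Cmod_circle; last lra.
  by move=> /(_ r1); have := Cmod_ge_0 (f (circle r t)); nra.
have := kernel_form_le (c := c) (d := fun i => c i * Cconj (f (z i)))%C
  (holomorphic_analytic af) hB dz.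
have E i : (Cconj (c i * Cconj (f (z i))) = Cconj (c i) * f (z i))%C.
  by rewrite Cmult_conj Cconj_conj.
move=> /(_ E); rewrite !kernel_form_1 !big_ord_recl !big_ord0.
have [z0 z1] : z ord0 = RtoC 0 /\ z (lift ord0 ord0) = a by [].
have [c0 c1] : c ord0 = (- (M / Cmod q ^ 2)%R * q)%C /\ c (lift ord0 ord0) = RtoC 1 by [].
rewrite {}z0 {}z1 {}c0 {}c1; clear E c z dz hB.
have a1 : Cmod a ^ 2 < 1 by have := Cmod_ge_0 a; rewrite /disk in da; nra.
have fa1 : Cmod (f a) ^ 2 < 1 by have := Cmod_ge_0 (f a); rewrite /disk in dfa; nra.
have f02 : Cmod (f 0) ^ 2 = 1 by rewrite f0; ring.
have M0 : 0 < M by apply: Rdiv_lt_0_compat; lra.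
have N0 : 0 < M / Cmod q ^ 2 by apply: Rdiv_lt_0_compat => //; apply: pow_lt.
have Nq : M / Cmod q ^ 2 * Cmod q ^ 2 = M by field; lra.
set N := M / _ in N0 Nq *.
have aa : (1 - a * Cconj a = RtoC (1 - Cmod a ^ 2))%C by rewrite -Cmod2_conj RtoC_minus.
have Me : M * (1 - Cmod a ^ 2) = 1 - Cmod (f a) ^ 2 by rewrite /M; field; lra.
set X := Cplus _ _; set Y := Cplus _ _ => XY.
have F2 : (f 0 * Cconj (f 0) = RtoC 1)%C by rewrite -Cmod2_conj f02.
have q2 : (q * Cconj q = RtoC (Cmod q ^ 2))%C by rewrite -Cmod2_conj.
have qE : (Cconj q = 1 - Cconj (f 0) * f a)%C.
  by rewrite /q Cminus_conj Cmult_conj Cconj_conj Cconj_RtoC.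
have ff : (1 - f a * Cconj (f a) = RtoC M * RtoC (1 - Cmod a ^ 2))%C.
  by rewrite -RtoC_mult Me RtoC_minus -Cmod2_conj.
have D0 : RtoC (1 - Cmod a ^ 2) <> RtoC 0 by move/RtoC_inj; lra.
have YX : (Y - X)%C = RtoC (- M).
  transitivity (N * N * (q * Cconj q) * (1 - f 0 * Cconj (f 0)) - 2 * N * (q * Cconj q)
      + (1 - f a * Cconj (f a)) / RtoC (1 - Cmod a ^ 2))%C.
    rewrite /X /Y aa !Cmult_conj !Copp_conj !Cconj_conj !Cconj_RtoC qE /q.
    by field.
  rewrite F2 q2 ff -Nq !RtoC_opp !RtoC_mult; field => //.
have : Re (Y - X) = - M by rewrite YX.
by rewrite /Cminus re_plus re_opp; lra.
Qed.

Theorem theorem4p3 (p : nat) (k : p.-tuple nat) (K : pred nat)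
    (hp : (1 <= p)%nat)
    (hk : path.sorted ltn (1%nat :: k))
    (hK : K =i 1%nat :: k)
    (hAlg : is_algebra (Hinf_vanishing K))
    (m : nat) (hm0 : (0 < m)%nat) (hmK : m \notin K)
    (hmin : forall j : nat, (0 < j)%nat -> j \notin K -> (m <= j)%nat)
    (n : nat) (z w : 'I_n -> C)
    (hz : forall i, disk (z i)) (hzinj : injective z)
    (hw : forall i, disk (w i)) :
  (exists f : C -> C,
     [/\ Hinf_vanishing K f,
         forall i, f (z i) = w i
       & Rbar_le (sup_norm f) 1%R]) ->
  exists lambda : C, disk lambda /\
    pos_semidef
      (\matrix_(i < n, j < n)
         ((z i ^ m * Cconj (z j ^ m)
             - mobius lambda (w i) * Cconj (mobius lambda (w j)))
          / (1 - z i * Cconj (z j)))%C).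
Proof.
move=> [f [[[af _] fK] fz nf]].
(* Without nodes [f] may be a unimodular constant, and then [f 0] is outside the disk; the form is
   empty, so [lambda = 0] serves. *)
case: n z w hz hzinj hw fz => [|n] z w hz _ hw fz.
  exists 0; split; first by rewrite /disk Cmod_0; lra.
  by move=> x; rewrite /quad_form big_ord0 /=; lra.
have f1 x : disk x -> Cmod (f x) <= 1.
  move=> dx; have [ub _] := Lub_Rbar_correct (fun x : R => exists z : C, disk z /\ x = Cmod (f z)).
  exact: Rbar_le_trans (ub (Cmod (f x)) (ex_intro _ x (conj dx erefl))) nf.
have dl : disk (f 0).
  by apply: (@bounded_disk_at0 f (z ord0)) => //; rewrite fz.
have fk j : (0 < j < m)%nat -> iter j C_derive f 0 = 0.
  move=> /andP[j0 jm]; apply: fK; apply: contraLR jm => jK.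
  by rewrite -leqNgt; apply: hmin.
have [h [h' [hh hE hB]]] := mobius_factor hm0 af f1 fk erefl dl.
exists (f 0); split => //; move: (mobius (f 0)) hE => g hE.
set A := (X in pos_semidef X) => x.
(* These vectors split the quadratic form as the kernel form of [c] minus that of [d], and
   [g (w i) = z i ^ m * h (z i)] relates them as required. *)
pose c i := (Cconj (z i ^ m) * x i)%C; pose d i := (Cconj (g (w i)) * x i)%C.
have dE i : (Cconj (d i) = Cconj (c i) * h (z i))%C.
  by rewrite /c /d !Cmult_conj !Cconj_conj -fz -hE //; ring.
have := kernel_form_le hh hB hz dE; rewrite !kernel_form_1 => dc.
have AE i j : A i j = ((z i ^ m * Cconj (z j ^ m)
    - g (w i) * Cconj (g (w j))) / (1 - z i * Cconj (z j)))%C.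
  by rewrite mxE.
have AC i j : Cconj (A i j) = A j i.
  have dn i' j' : (1 - z i' * Cconj (z j'))%C <> RtoC 0.
    apply: Cmod_lt1_neq0; rewrite Cmod_mult Cmod_conj.
    have := hz i'; have := hz j'; rewrite /disk.
    by have := Cmod_ge_0 (z i'); have := Cmod_ge_0 (z j'); nra.
  rewrite !AE Cdiv_conj // !Cminus_conj !Cmult_conj !Cconj_conj Cconj_RtoC.
  by congr (_ / _)%C; ring.
split.
  have : Cconj (quad_form A x) = quad_form A x.
    rewrite {1}/quad_form csum_conj (eq_bigr (fun i => \csum_j (Cconj (x j) * A j i * x i))).
      by rewrite exchange_big.
    move=> i _; rewrite csum_conj; apply: eq_bigr => j _.
    by rewrite !Cmult_conj AC Cconj_conj; ring.
  by move/(congr1 Im); rewrite im_conj; lra.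
move: dc; set S1 := \csum_i _; set S2 := \csum_i _.
have -> : quad_form A x = (S2 - S1)%C.
  rewrite /Cminus /S1 (big_morph Copp Copp_plus_distr (Copp_0)) -big_split.
  apply: eq_bigr => i _.
  rewrite (big_morph Copp Copp_plus_distr (Copp_0)) -big_split.
  apply: eq_bigr => j _ /=.
  by rewrite AE /c /d !Cmult_conj !Cconj_conj /Cdiv; ring.
by rewrite /Cminus re_plus re_opp; lra.
Qed.
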